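(* $\vec{T} = \langle \vec{F}, f_{\frac12}\rangle = \langle x_0x_1,\; x_1x_2,\; x_2x_3,\; f_{\frac12}\rangle$ as subgroups of Thompson's group $T$.
   Context: **Trees and $T$.** A full binary tree is a finite rooted plane tree in which every vertex has either $0$ children or $2$ children (a left and a right one); leaves are numbered $1,2,\dots$ from left to right. Associate $[0,1)$ with the root, and if $[a,b)$ is associated with a vertex, associate $[a,\frac{a+b}2)$ with its left child and $[\frac{a+b}2,b)$ with its right child. Given full binary trees $R,S$ with the same number $m$ of leaves and $1\le n\le m$, the triple $(R,S,n)$ represents the homeomorphism of the circle $[0,1]/(0\sim 1)$ which, for each $i$, maps the interval of leaf $i$ of $R$ affinely and increasingly onto the interval of leaf $i+n-1$ (taken mod $m$ in $\{1,\dots,m\}$) of $S$; leaf $i$ of $R$ is said to be identified with leaf $i+n-1$ of $S$. Thompson's group $T$ is the group of all homeomorphisms so represented; products are composed from left to right, $(fg)(t)=g(f(t))$. $F\le T$ is the stabilizer of $0$. A triple is reduced if there is no caret in $R$ both of whose children are leaves that are identified (left with left, right with right) with the two leaf children of a caret of $S$; every element of $T$ has a unique reduced triple. **Thompson graphs.** For a full binary tree with leaves $l_1,\dots,l_m$ arranged on a horizontal line, its Thompson graph has vertices $v_1,\dots,v_m$ on that line, $v_1$ to the left of $l_1$ and $v_i$ between $l_{i-1}$ and $l_i$; for each left edge $e$ of the tree, the unique pair $v_i,v_j$ that can be joined by a path above the line crossing the tree only at $e$ is joined by an edge. (Equivalently: for each non-leaf vertex $p$, join $v_i$ to $v_j$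 where $l_i$ is the leftmost leaf below the left child of $p$ and $l_j$ is the leftmost leaf below the right child of $p$.) The Thompson graph of $f\in T$ with reduced triple $(R,S,n)$ is obtained from the Thompson graphs of $R$ and $S$ by identifying their vertices in the same way as the leaves (the $i$th vertex for $R$ with the $(i+n-1)$st, mod $m$, for $S$). $\vec T$ is the subgroup of all $f\in T$ whose Thompson graph is bipartite, and $\vec F=\vec T\cap F$. **Elements.** $x_0(t)=2t$ on $[0,\frac14)$, $t+\frac14$ on $[\frac14,\frac12)$, $\frac12t+\frac12$ on $[\frac12,1)$. For $n\ge1$, $x_n(t)=t$ on $[0,\frac12]$ and $x_n(t)=\frac{x_{n-1}(2t-1)+1}{2}$ on $(\frac12,1]$. $f_{\frac12}(t)=t+\frac12 \bmod 1$. *)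

(* Defs.v *)
From HB Require Import structures.
From mathcomp Require Import all_boot all_order all_algebra.
From mathcomp Require Import boolp classical_sets reals.
From mathcomp Require Import lra.

Set Implicit Arguments.
Unset Strict Implicit.
Unset Printing Implicit Defensive.

Import Order.TTheory GRing.Theory Num.Theory.

(* Group of all bijections of a type, with products composed from left to
   right: (f * g) t = g (f t). *)
Record selfbij (X : Type) := SelfBij {
  bij_fun :> X -> X;
  bij_inv : X -> X;
  bij_funK : cancel bij_fun bij_inv;
  bij_invK : cancel bij_inv bij_fun
}.

Section SelfBijGroup.
Variable X : Type.
Implicit Types f g h : selfbij X.

HB.instance Definition _ := gen_eqMixin (selfbij X).
HB.instance Definition _ := gen_choiceMixin (selfbij X).

Lemma selfbij_ext f g : f =1 g -> f = g.
Proof.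
case: f g => [f f' fK f'K] [g g' gK g'K] /= fg.
have eqf : f = g by apply/funext.
have eqi : f' = g' by apply/funext => t; rewrite -[t in LHS]g'K -eqf fK.
by subst g g'; congr SelfBij; exact: Prop_irrelevance.
Qed.

Definition selfbij_one : selfbij X :=
  @SelfBij X id id (fun=> erefl) (fun=> erefl).

Definition selfbij_inv f : selfbij X :=
  SelfBij (@bij_invK X f) (@bij_funK X f).

Definition selfbij_mul f g : selfbij X :=
  SelfBij (can_comp (@bij_funK X g) (@bij_funK X f))
          (can_comp (@bij_invK X f) (@bij_invK X g)).

Fact selfbij_mulA : associative selfbij_mul.
Proof. by move=> f g h; apply: selfbij_ext. Qed.
Fact selfbij_mul1 : left_id selfbij_one selfbij_mul.
Proof. by move=> f; apply: selfbij_ext. Qed.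
Fact selfbij_mulr1 : right_id selfbij_one selfbij_mul.
Proof. by move=> f; apply: selfbij_ext. Qed.
Fact selfbij_mulV : left_inverse selfbij_one selfbij_inv selfbij_mul.
Proof. by move=> f; apply: selfbij_ext => t /=; rewrite bij_invK. Qed.
Fact selfbij_mulrV : right_inverse selfbij_one selfbij_inv selfbij_mul.
Proof. by move=> f; apply: selfbij_ext => t /=; rewrite bij_funK. Qed.

HB.instance Definition _ := isGroup.Build (selfbij X)
  selfbij_mulA selfbij_mul1 selfbij_mulr1 selfbij_mulV selfbij_mulrV.

End SelfBijGroup.

Definition generated (G : groupType) (A : set G) : set G :=
  smallest [set H : set G | group_closed (mem H)]%classic A.

Inductive tree := Leaf | Node of tree & tree.

Fixpoint nleaves (t : tree) : nat :=
  if t is Node l r then (nleaves l + nleaves r)%N else 1%N.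

(* Leaves, and the vertices of Thompson graphs, are numbered from 0: number i
   here is the (i+1)-st leaf from the left. The functions below take the
   number k of the leftmost leaf of the subtree t. *)

(* The i such that leaves i and i.+1 are the two children of one caret. *)
Fixpoint leaf_carets (k : nat) (t : tree) : seq nat :=
  match t with
  | Leaf => [::]
  | Node Leaf Leaf => [:: k]
  | Node l r => leaf_carets k l ++ leaf_carets (k + nleaves l) r
  end.

(* One pair for each non-leaf vertex p: the leftmost leaves below the left and
   right children of p. *)
Fixpoint tree_edges (k : nat) (t : tree) : seq (nat * nat) :=
  if t is Node l r then
    (k, (k + nleaves l)%N) :: tree_edges k l ++ tree_edges (k + nleaves l) r
  else [::].

Definition tree_graph (t : tree) : rel 'I_(nleaves t) :=
  [rel u v | ((val u, val v) \in tree_edges 0 t)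
          || ((val v, val u) \in tree_edges 0 t)].

Record triple := Triple {
  dom_tree : tree;
  cod_tree : tree;
  shift : nat;
  _ : nleaves dom_tree = nleaves cod_tree;
  _ : (1 <= shift <= nleaves dom_tree)%N
}.

(* With 1-based leaves this is i |-> i + n - 1, mod m in {1, ..., m}. *)
Definition ident (D : triple) (i : nat) : nat :=
  ((i + (shift D).-1) %% nleaves (cod_tree D))%N.

Definition reduced (D : triple) : Prop :=
  ~ exists i j : nat,
      [/\ i \in leaf_carets 0 (dom_tree D), j \in leaf_carets 0 (cod_tree D),
          ident D i = j & ident D i.+1 = j.+1].

(* The two tree graphs glued along ident; the vertices are named by those of
   the graph of the range tree. *)
Definition thompson_graph (D : triple) : rel 'I_(nleaves (cod_tree D)) :=
  [rel u v | tree_graph u v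
    || [exists x : 'I_(nleaves (dom_tree D)),
        exists y : 'I_(nleaves (dom_tree D)),
          [&& ident D x == u, ident D y == v & tree_graph x y]]].

Definition bipartite (V : Type) (e : rel V) : Prop :=
  exists c : V -> bool, forall u v, e u v -> c u != c v.

Local Open Scope ring_scope.
Local Open Scope classical_set_scope.

(* The circle [0, 1] / (0 ~ 1), through its fundamental domain [0, 1). *)
Definition circle (R : realType) : Type := {t : R | 0 <= t < 1}.

Section ThompsonGroups.
Variable R : realType.

(* Endpoints (a, b) of the intervals [a, b) of the leaves, from left to right,
   of a subtree whose root has the interval [a, b). *)
Fixpoint leaf_intervals (t : tree) (a b : R) : seq (R * R) :=
  if t is Node l r then
    leaf_intervals l a ((a + b) / 2) ++ leaf_intervals r ((a + b) / 2) b
  else [:: (a, b)].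

Definition represents (D : triple) (f : selfbij (circle R)) : Prop :=
  forall i : nat, (i < nleaves (dom_tree D))%N ->
  let I := nth (0, 0) (leaf_intervals (dom_tree D) 0 1) i in
  let J := nth (0, 0) (leaf_intervals (cod_tree D) 0 1) (ident D i) in
  forall t : circle R, I.1 <= val t < I.2 ->
  val (f t) = J.1 + (J.2 - J.1) / (I.2 - I.1) * (val t - I.1).

(* T is taken as a subset of the group of all bijections of the circle: a
   bijection represented by a triple is a homeomorphism, and a subset of T
   generates the same subgroup in both groups. *)
Definition thompson_T : set (selfbij (circle R)) :=
  [set f | exists D, represents D f].

Definition thompson_F : set (selfbij (circle R)) :=
  thompson_T `&` [set f | forall t : circle R, val t = 0 -> val (f t) = 0].

(* The reduced triple of an element of T is unique. *)
Definition vec_T : set (selfbij (circle R)) :=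
  thompson_T `&` [set f | exists D,
    [/\ reduced D, represents D f & bipartite (@thompson_graph D)]].

Definition vec_F : set (selfbij (circle R)) := vec_T `&` thompson_F.

Definition circle_map (f : R -> R)
    (f01 : forall t, 0 <= t < 1 -> 0 <= f t < 1) (t : circle R) : circle R :=
  exist _ (f (val t)) (f01 (val t) (valP t)).

Fact circle_mapK (f g : R -> R) f01 g01 :
  (forall t, 0 <= t < 1 -> g (f t) = t) ->
  cancel (@circle_map f f01) (@circle_map g g01).
Proof. by move=> fK t; apply: val_inj; exact: fK (valP t). Qed.

Fixpoint x_fun (n : nat) (t : R) : R :=
  if n is n'.+1 then
    if t <= 1 / 2 then t else (x_fun n' (2 * t - 1) + 1) / 2
  else if t < 1 / 4 then 2 * t
  else if t < 1 / 2 then t + 1 / 4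
  else 1 / 2 * t + 1 / 2.

Fixpoint x_fun_inv (n : nat) (t : R) : R :=
  if n is n'.+1 then
    if t <= 1 / 2 then t else (x_fun_inv n' (2 * t - 1) + 1) / 2
  else if t < 1 / 2 then t / 2
  else if t < 3 / 4 then t - 1 / 4
  else 2 * t - 1.

Fact x_fun_gt0 n t : 0 < t -> 0 < x_fun n t.
Proof.
elim: n t => [|n IHn] t t0 /=.
  by case: (ltP t (1 / 4)) => ?; [lra|case: (ltP t (1 / 2)) => ?; lra].
by case: (leP t (1 / 2)) => // t12; have := IHn (2 * t - 1); lra.
Qed.

Fact x_fun_inv_gt0 n t : 0 < t -> 0 < x_fun_inv n t.
Proof.
elim: n t => [|n IHn] t t0 /=.
  by case: (ltP t (1 / 2)) => ?; [lra|case: (ltP t (3 / 4)) => ?; lra].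
by case: (leP t (1 / 2)) => // t12; have := IHn (2 * t - 1); lra.
Qed.

Fact x_fun01 n t : 0 <= t < 1 -> 0 <= x_fun n t < 1.
Proof.
elim: n t => [|n IHn] t t01 /=.
  by case: (ltP t (1 / 4)) => ?; [lra|case: (ltP t (1 / 2)) => ?; lra].
by case: (leP t (1 / 2)) => // t12; have := IHn (2 * t - 1); lra.
Qed.

Fact x_fun_inv01 n t : 0 <= t < 1 -> 0 <= x_fun_inv n t < 1.
Proof.
elim: n t => [|n IHn] t t01 /=.
  by case: (ltP t (1 / 2)) => ?; [lra|case: (ltP t (3 / 4)) => ?; lra].
by case: (leP t (1 / 2)) => // t12; have := IHn (2 * t - 1); lra.
Qed.

Fact x_funK n t : x_fun_inv n (x_fun n t) = t.
Proof.
elim: n t => [|n IHn] t /=.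
  case: (ltP t (1 / 4)) => t4; first by rewrite ifT; lra.
  case: (ltP t (1 / 2)) => t2; first by rewrite ifF ?ifT; lra.
  by rewrite ifF ?ifF; lra.
case: (leP t (1 / 2)) => t12; first by rewrite t12.
have x0 : 0 < x_fun n (2 * t - 1) by apply: x_fun_gt0; lra.
rewrite ifF; last by lra.
have -> : 2 * ((x_fun n (2 * t - 1) + 1) / 2) - 1 = x_fun n (2 * t - 1) by lra.
by rewrite IHn; lra.
Qed.

Fact x_fun_invK n t : x_fun n (x_fun_inv n t) = t.
Proof.
elim: n t => [|n IHn] t /=.
  case: (ltP t (1 / 2)) => t2; first by rewrite ifT; lra.
  case: (ltP t (3 / 4)) => t4; first by rewrite ifF ?ifT; lra.
  by rewrite ifF ?ifF; lra.
case: (leP t (1 / 2)) => t12; first by rewrite t12.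
have x0 : 0 < x_fun_inv n (2 * t - 1) by apply: x_fun_inv_gt0; lra.
rewrite ifF; last by lra.
have -> : 2 * ((x_fun_inv n (2 * t - 1) + 1) / 2) - 1 = x_fun_inv n (2 * t - 1).
  by lra.
by rewrite IHn; lra.
Qed.

Definition x_ (n : nat) : selfbij (circle R) :=
  SelfBij (circle_mapK (@x_fun01 n) (@x_fun_inv01 n) (fun t _ => x_funK n t))
    (circle_mapK (@x_fun_inv01 n) (@x_fun01 n) (fun t _ => x_fun_invK n t)).

Definition half_turn_fun (t : R) : R :=
  if t < 1 / 2 then t + 1 / 2 else t - 1 / 2.

Fact half_turn_fun01 t : 0 <= t < 1 -> 0 <= half_turn_fun t < 1.
Proof. by move=> t01; rewrite /half_turn_fun; case: (ltP t (1 / 2)) => ?; lra. Qed.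

Fact half_turn_funK t : 0 <= t < 1 -> half_turn_fun (half_turn_fun t) = t.
Proof.
move=> t01; rewrite /half_turn_fun.
by case: (ltP t (1 / 2)) => ?; [rewrite ifF|rewrite ifT]; lra.
Qed.

Definition half_turn : selfbij (circle R) :=
  SelfBij (circle_mapK half_turn_fun01 half_turn_fun01 half_turn_funK)
          (circle_mapK half_turn_fun01 half_turn_fun01 half_turn_funK).

End ThompsonGroups.

Arguments thompson_T R : clear implicits.
Arguments thompson_F R : clear implicits.
Arguments vec_T R : clear implicits.
Arguments vec_F R : clear implicits.

(* Main.v *)
(* Name a leaf by the word [u] of left and right turns leading to it and colour
   it by the parity of the number of right turns in [u]. Each edge of the
   Thompson graph of a tree joins two leaves of different colours and the graph
   is connected, so this is its only 2-colouring up to exchange. Hence a triple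
   has a bipartite Thompson graph iff the identified leaves have the same
   colour everywhere or different colours everywhere, a condition that is
   stable under adding and removing carets; so vec T is a group containing the
   generators.

   Conversely, add a caret to each leaf with the same colour as the cyclically
   next one: the colours then alternate, in both trees. In a tree with
   alternating colours no left child is a caret, so that the tree reduces to a
   right comb by repeatedly removing a fork, i.e. a right comb with three
   leaves; on a comb, grafting a fork on leaf [i] is undone by
   [y_ i = x_ i * x_ i.+1]. It remains to generate the rotations of the combs
   with an even number of leaves, by induction from the half turn, and all
   [y_ i], by conjugation with [y_ 0]. *)

Require Import Defs.
From mathcomp Require Import all_boot all_order all_algebra.
From mathcomp Require Import boolp classical_sets reals.
From mathcomp Require Import ring lra zify.

Set Implicit Arguments.
Unset Strict Implicit.
Unset Printing Implicit Defensive.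

Import Order.TTheory GRing.Theory Num.Theory.

(** * Leaves of trees as words *)

Section Words.

Local Notation word := (seq bool).

Definition parity (u : word) : bool := odd (count id u).

Lemma parity_cat u v : parity (u ++ v) = parity u (+) parity v.
Proof. by rewrite /parity count_cat oddD. Qed.

Fixpoint leaves (t : tree) : seq word :=
  if t is Node l r then
    map (cons false) (leaves l) ++ map (cons true) (leaves r)
  else [:: [::]].

Lemma size_leaves t : size (leaves t) = nleaves t.
Proof. by elim: t => //= l IHl r IHr; rewrite size_cat !size_map IHl IHr. Qed.

Lemma nleaves_gt0 t : (0 < nleaves t)%N.
Proof. by elim: t => //= l IHl r _; rewrite addn_gt0 IHl. Qed.

Lemma leaves_neq0 t : exists u P, leaves t = u :: P.
Proof.
have := nleaves_gt0 t; rewrite -size_leaves.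
by case: (leaves t) => // u P _; exists u, P.
Qed.

Definition code (P : seq word) := exists t, P = leaves t.

Lemma code_leaves t : code (leaves t). Proof. by exists t. Qed.
Hint Resolve code_leaves : core.

Lemma code_node P Q :
  code P -> code Q -> code (map (cons false) P ++ map (cons true) Q).
Proof. by move=> [s ->] [t ->]; exists (Node s t). Qed.

Definition rcode (P : seq word) := exists k, code (rot k P).

Lemma code_rcode P : code P -> rcode P.
Proof. by move=> cP; exists 0%N; rewrite rot0. Qed.

Lemma rcode_rot k P : rcode P -> rcode (rot k P).
Proof.
move=> [j cP]; rewrite -[P](rotK k) /rotr rot_rot_add in cP.
by eexists; exact: cP.
Qed.

Definition refine (L : seq (word * tree)) : seq word :=
  flatten [seq [seq p.1 ++ w | w <- leaves p.2] | p <- L].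

Lemma refine_cat L1 L2 : refine (L1 ++ L2) = refine L1 ++ refine L2.
Proof. by rewrite /refine map_cat flatten_cat. Qed.

Lemma refine_cons p L :
  refine (p :: L) = [seq p.1 ++ w | w <- leaves p.2] ++ refine L.
Proof. by []. Qed.

Lemma refine_leaf P : refine [seq (u, Leaf) | u <- P] = P.
Proof. by elim: P => //= u P IHP; rewrite refine_cons IHP /= cats0. Qed.

Lemma refine_map u L :
  refine [seq (u ++ p.1, p.2) | p <- L] = [seq u ++ v | v <- refine L].
Proof.
elim: L => //= p L IHL; rewrite !refine_cons IHL map_cat -map_comp /=.
by congr (_ ++ _); apply: eq_map => w /=; rewrite catA.
Qed.

Lemma code_refine L : code (unzip1 L) -> code (refine L).
Proof.
move=> [t]; elim: t L => [|l IHl r IHr] L /=.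
  case: L => [|[u t] [|//]] //= [->].
  by rewrite /refine /= cats0 map_id.
move=> eL; have [L1 [L2 [-> e1 e2]]] : exists L1 L2, [/\ L = L1 ++ L2,
    unzip1 L1 = map (cons false) (leaves l) &
    unzip1 L2 = map (cons true) (leaves r)].
  exists (take (size (leaves l)) L), (drop (size (leaves l)) L).
  rewrite cat_take_drop /unzip1 map_take map_drop -/(unzip1 L) eL.
  by rewrite take_size_cat ?drop_size_cat ?size_map.
have strip b (K : seq (word * tree)) s : unzip1 K = map (cons b) (leaves s) ->
    exists2 K', unzip1 K' = leaves s & K = [seq ([:: b] ++ p.1, p.2) | p <- K'].
  move=> eK; exists (zip (leaves s) (unzip2 K)).
    rewrite unzip1_zip //.
    by have := congr1 size eK; rewrite !size_map => ->.
  rewrite -{1}[K]zip_unzip eK.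
  by elim: (leaves s) (unzip2 K) => [|v P IHP] [|x Q] //=; rewrite IHP.
have [K1 eK1 ->] := strip _ _ _ e1; have [K2 eK2 ->] := strip _ _ _ e2.
by rewrite refine_cat !refine_map; apply: code_node; [exact: IHl|exact: IHr].
Qed.

Lemma rcode_refine L : rcode (unzip1 L) -> rcode (refine L).
Proof.
move=> [k cL]; exists (size (refine (take k L))).
rewrite -{2}(cat_take_drop k L) refine_cat rot_size_cat -refine_cat.
by apply: code_refine; rewrite -/(rot k L) /unzip1 map_rot.
Qed.

Definition caret := Node Leaf Leaf.

Lemma rcode_split X u Y :
  rcode (X ++ u :: Y) -> rcode (X ++ rcons u false :: rcons u true :: Y).
Proof.
pose L := [seq (x, Leaf) | x <- X] ++ (u, caret) :: [seq (y, Leaf) | y <- Y].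
have -> : X ++ u :: Y = unzip1 L.
  by rewrite /L /unzip1 map_cat /= -!map_comp !map_id.
move/rcode_refine; rewrite /L refine_cat refine_cons !refine_leaf /=.
by rewrite !cats1.
Qed.

Fixpoint subtree (t : tree) (u : word) {struct u} : tree :=
  match u, t with
  | b :: u', Node l r => subtree (if b then r else l) u'
  | _, _ => t
  end.

Lemma subtree_leaf u : subtree Leaf u = Leaf. Proof. by case: u. Qed.

Fixpoint merge_tree (s t : tree) : tree :=
  match s, t with
  | Leaf, _ => t
  | _, Leaf => s
  | Node a b, Node c d => Node (merge_tree a c) (merge_tree b d)
  end.

Lemma merge_treeC s t : merge_tree s t = merge_tree t s.
Proof. by elim: s t => [|a IHa b IHb] [|c d] //=; rewrite IHa IHb. Qed.

Lemma leaves_merge s t :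
  leaves (merge_tree s t) = refine [seq (u, subtree t u) | u <- leaves s].
Proof.
elim: s t => [|a IHa b IHb] t /=.
  rewrite /refine /= cats0 /=.
  by rewrite map_id.
case: t => [|c d].
  rewrite -[LHS]refine_leaf /=; congr refine.
  by apply: eq_map => u; rewrite subtree_leaf.
rewrite /= map_cat refine_cat -!map_comp IHa IHb.
rewrite -[map (cons false) _](refine_map [:: false]).
by rewrite -[map (cons true) _](refine_map [:: true]) -!map_comp.
Qed.

Definition alternating (s : seq bool) := cycle (fun a b => a != b) s.

Lemma parity_head t : head true (map parity (leaves t)) = false.
Proof.
elim: t => //= l IHl r _; have [u [P eP]] := leaves_neq0 l.
by rewrite eP in IHl *.
Qed.

Lemma sorted_negb s :
  sorted (fun a b => a != b) (map negb s) = sorted (fun a b => a != b) s.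
Proof.
case: s => //= a s; elim: s a => //= b s IHs a.
by rewrite IHs; case: a b => [] [].
Qed.

Lemma map_parity_cons b P :
  map parity (map (cons b) P) = map (addb b) (map parity P).
Proof.
by rewrite -!map_comp; apply: eq_map => u; rewrite /= -cat1s parity_cat; case: b.
Qed.

(* With alternating colours, no left child is a caret, since its right leaf and
   the leaf after it would have the same colour. *)
Lemma alternating_leaves t :
  sorted (fun a b => a != b) (map parity (leaves t)) ->
  [\/ t = Leaf, t = caret | exists X u Y,
    leaves t = X ++ [:: u ++ [:: false]; u ++ [:: true; false];
                        u ++ [:: true; true]] ++ Y
    /\ code (X ++ u :: Y)].
Proof.
elim: t => [|l IHl r IHr] /=; first by constructor 1.
rewrite map_cat !map_parity_cons map_id => alt.
have [altl altr] := cat_sorted2 alt; rewrite sorted_negb in altr.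
case: (IHl altl) => [el|el|[X [u [Y [eP cP]]]]].
- rewrite {}el {l IHl altl} /= in alt *.
  case: (IHr altr) => [->|->|[X [u [Y [eP cP]]]]]; first by constructor 2.
    constructor 3; exists [::], [::], [::]; split=> //.
    exact: (code_leaves Leaf).
  constructor 3; exists ([:: false] :: map (cons true) X), (true :: u).
  exists (map (cons true) Y); split; first by rewrite eP /= map_cat.
  have := code_node (code_leaves Leaf) cP.
  by rewrite /= map_cat.
- rewrite el /= in alt; have := parity_head r; have [v [Q eQ]] := leaves_neq0 r.
  by move: alt; rewrite eQ /=; case: (parity v).
- constructor 3; exists (map (cons false) X), (false :: u).
  exists (map (cons false) Y ++ map (cons true) (leaves r)); split.
    by rewrite eP !map_cat -!catA.
  have := code_node cP (code_leaves r).
  by rewrite map_cat /= -catA.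
Qed.

Lemma alternating_remove X a b c Y :
  alternating (X ++ a :: b :: c :: Y) -> alternating (X ++ c :: Y).
Proof.
rewrite /alternating -(rot_cycle (size X)) rot_size_cat.
rewrite -[in X in _ -> X](rot_cycle (size X)) rot_size_cat /=.
case/and3P=> ab bc; suff -> : a = c by [].
by move: ab bc; case: a b c => [] [] [].
Qed.

Lemma alternating_addb e s : alternating (map (addb e) s) = alternating s.
Proof.
have pathE a p : path (fun b c => b != c) (e (+) a) (map (addb e) p) =
    path (fun b c => b != c) a p.
  elim: p a => //= b p IHp a; rewrite IHp; congr (_ && _).
  by case: e a b {IHp} => [] [] [].
by case: s => //= a p; rewrite /alternating /= -map_rcons pathE.
Qed.

Lemma path_neq_last a s :
  path (fun b c => b != c) a s -> last a s = a (+) odd (size s).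
Proof.
elim: s a => [|c s IHs] a /=; first by rewrite addbF.
by case/andP=> ac /IHs ->; move: ac; case: a c (odd _) => [] [] [].
Qed.

Lemma alternating_even s : alternating s -> ~~ odd (size s).
Proof.
case: s => //= a s /path_neq_last; rewrite last_rcons size_rcons /=.
by case: a (odd _) => [] [].
Qed.

Fixpoint comb (n : nat) : seq word :=
  if n is n'.+1 then [:: false] :: map (cons true) (comb n') else [:: [::]].

Definition tooth (i : nat) : word := rcons (nseq i true) false.

Lemma code_comb n : code (comb n).
Proof.
by elim: n => [|n /(code_node (code_leaves Leaf))] //; exact: (code_leaves Leaf).
Qed.

Lemma size_comb n : size (comb n) = n.+1.
Proof. by elim: n => //= n IHn; rewrite size_map IHn. Qed.

Lemma mkseq_toothS i :
  mkseq tooth i.+1 = [:: false] :: map (cons true) (mkseq tooth i).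
Proof.
by rewrite /mkseq /= (iotaDl 1) -!map_comp.
Qed.

Lemma comb_add i r :
  comb (i + r) = mkseq tooth i ++ map (cat (nseq i true)) (comb r).
Proof.
elim: i => [|i IHi]; first by rewrite /= map_id.
by rewrite addSn mkseq_toothS /= IHi map_cat -map_comp.
Qed.

Lemma rot_comb n :
  rot 1 (comb n.+1) =
  map (cons true) (mkseq tooth n) ++ [:: nseq n.+1 true; [:: false]].
Proof.
by rewrite /= rot1_cons -{1}[n]addn0 comb_add map_cat /= cats0 -!cats1 -catA.
Qed.

(* The tree attached to a word is a caret when the next word, cyclically, has
   the same colour; [q] is the colour following the last word. *)
Fixpoint separators (q : bool) (cs : seq bool) : seq tree :=
  if cs is c :: cs' then
    (if c == head q cs' then caret else Leaf) :: separators q cs'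
  else [::].

Lemma size_separators q cs : size (separators q cs) = size cs.
Proof. by elim: cs => //= c cs ->. Qed.

Lemma alternating_separators P : P != [::] ->
  alternating (map parity
    (refine (zip P (separators (head true (map parity P)) (map parity P))))).
Proof.
case: P => // u P _; rewrite [head _ _]/=.
suff gen q Q : let E := map parity (refine (zip Q (separators q (map parity Q))))
    in sorted (fun a b => a != b) (rcons E q) /\ head q E = head q (map parity Q).
  have [] := gen (parity u) (u :: P).
  set E := map parity (refine _); case: E => //= a s alt ea.
  by rewrite -ea in alt.
move: Q {u P}; elim=> [|u P [IH1 IH2]] //=; rewrite refine_cons map_cat /=.
move: IH1 IH2; set h := head q (map parity P); set E := map parity (refine _) => IH1 IH2.
have eE : exists s, rcons E q = h :: s.
  by move: IH2; case: (E) => [|a E'] /= <-; eexists.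
have [s es] := eE; rewrite es in IH1.
case: eqP => [ec|/eqP nc] /=; rewrite ?cats0 -/E es.
  rewrite !parity_cat /= addbF addbT.
  by split=> //; move: IH1 => /= ->; rewrite -ec; case: (parity u).
by split=> //; move: IH1 => /= ->; rewrite nc.
Qed.

End Words.

(** * Bijections carrying a sequence of cells to another one *)

Section Maps.
Variable R : realType.

Local Notation word := (seq bool).
Local Open Scope ring_scope.

Implicit Types (f g : selfbij (circle R)) (u v w : word) (P Q : seq word).

Fixpoint cell (u : word) (x : R) : R :=
  if u is b :: u' then ((if b then 1 else 0) + cell u' x) / 2 else x.

Lemma cell_cat u v x : cell (u ++ v) x = cell u (cell v x).
Proof. by elim: u => //= b u ->. Qed.

Lemma cell01 u x : 0 <= x < 1 -> 0 <= cell u x < 1.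
Proof. move=> x01; elim: u => //= -[] u IHu; lra. Qed.

Lemma cell_affine u x : cell u x = cell u 0 + (cell u 1 - cell u 0) * x.
Proof. by elim: u => [|b u /= ->] /=; [lra|case: b; lra]. Qed.

Lemma cell_lt u : cell u 0 < cell u 1.
Proof. by elim: u => [|[] u /= IHu] /=; lra. Qed.

Lemma cell_cover t x : 0 <= x < 1 ->
  exists2 u, u \in leaves t & exists2 y, 0 <= y < 1 & x = cell u y.
Proof.
elim: t x => [|l IHl r IHr] x x01; first by exists [::]; rewrite ?inE //; exists x.
case: (ltP x (1 / 2)) => x2.
  have [|u ul [y y01 ey]] := IHl (2 * x); first by lra.
  exists (false :: u); first by rewrite mem_cat map_f.
  by exists y => //=; rewrite -ey; lra.
have [|u ur [y y01 ey]] := IHr (2 * x - 1); first by lra.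
exists (true :: u); first by rewrite mem_cat map_f ?orbT.
by exists y => //=; rewrite -ey; lra.
Qed.

Definition maps f u v := forall x (t : circle R),
  0 <= x < 1 -> val t = cell u x -> val (f t) = cell v x.

Lemma mapsM f g u v w : maps f u v -> maps g v w -> maps (f * g)%g u w.
Proof. by move=> fuv gvw x t x01 /fuv/gvw; apply. Qed.

Lemma mapsV f u v : maps f u v -> maps f^-1%g v u.
Proof.
move=> fuv x t x01 et; pose s : circle R := exist (fun y : R => is_true (0 <= y < 1)) _ (cell01 u x01).
suff <- : f s = t by rewrite [f^-1%g _]bij_funK.
by apply: val_inj; rewrite et; apply: fuv.
Qed.

Lemma maps_cat f u v w : maps f u v -> maps f (u ++ w) (v ++ w).
Proof.
move=> fuv x t x01; rewrite !cell_cat; apply: fuv; exact: cell01.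
Qed.

Lemma maps_join f u v :
  maps f (rcons u false) (rcons v false) ->
  maps f (rcons u true) (rcons v true) -> maps f u v.
Proof.
move=> f0 f1 x t x01 et; case: (ltP x (1 / 2)) => x2.
  have e w : cell (rcons w false) (2 * x) = cell w x.
    by rewrite -cats1 cell_cat; congr cell => /=; lra.
  by rewrite -e; apply: f0; rewrite ?e //; lra.
have e w : cell (rcons w true) (2 * x - 1) = cell w x.
  by rewrite -cats1 cell_cat; congr cell => /=; lra.
by rewrite -e; apply: f1; rewrite ?e //; lra.
Qed.

Definition carries f P Q :=
  size P = size Q /\ forall p, p \in zip P Q -> maps f p.1 p.2.

Lemma carries_nil f : carries f [::] [::]. Proof. by []. Qed.

Lemma carries_cons f u v P Q :
  maps f u v -> carries f P Q -> carries f (u :: P) (v :: Q).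
Proof.
move=> fuv [eS fPQ]; split=> [|p]; first by rewrite /= eS.
by rewrite inE => /orP[/eqP ->|/fPQ].
Qed.

Lemma carries_consP f u v P Q :
  carries f (u :: P) (v :: Q) -> maps f u v /\ carries f P Q.
Proof.
move=> [[eS] fPQ]; split; first by apply: (fPQ (u, v)); rewrite inE eqxx.
by split=> // p pPQ; apply: fPQ; rewrite inE pPQ orbT.
Qed.

Lemma carries_cat f P1 Q1 P2 Q2 : size P1 = size Q1 ->
  carries f (P1 ++ P2) (Q1 ++ Q2) <-> carries f P1 Q1 /\ carries f P2 Q2.
Proof.
elim: P1 Q1 => [|u P1 IHP] [|v Q1] //= => [_|[/IHP IH]].
  by split=> [|[]] //; split.
split=> [/carries_consP[fuv /IH[f1 f2]]|[/carries_consP[fuv f1] f2]].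
  by split=> //; apply: carries_cons.
by apply: carries_cons => //; apply/IH.
Qed.

Lemma carries_map f (T : eqType) (a b : T -> word) (s : seq T) :
  (forall i, i \in s -> maps f (a i) (b i)) -> carries f (map a s) (map b s).
Proof.
elim: s => [|i s IHs] fab /=; first exact: carries_nil.
apply: carries_cons; first by apply: fab; rewrite inE eqxx.
by apply: IHs => j js; apply: fab; rewrite inE js orbT.
Qed.

Lemma carries1 P : carries 1%g P P.
Proof.
by elim: P => [|u P IHP]; [exact: carries_nil|exact: carries_cons].
Qed.

Lemma carriesM f g P Q S : carries f P Q -> carries g Q S -> carries (f * g)%g P S.
Proof.
elim: P Q S => [|u P IHP] [|v Q] [|w S] //; try by [case|move=> _ []].
move=> /carries_consP[fuv fPQ] /carries_consP[gvw gQS].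
by apply: carries_cons; [apply: mapsM gvw|apply: IHP gQS].
Qed.

Lemma carriesV f P Q : carries f P Q -> carries f^-1%g Q P.
Proof.
elim: P Q => [|u P IHP] [|v Q] //; try by case.
move=> /carries_consP[fuv fPQ].
by apply: carries_cons; [apply: mapsV|apply: IHP].
Qed.

Lemma carries_rot k f P Q : carries f P Q -> carries f (rot k P) (rot k Q).
Proof.
move=> fPQ; have eS := fPQ.1; have eSt : size (take k P) = size (take k Q).
  by rewrite !size_take eS.
have eSd : size (drop k P) = size (drop k Q) by rewrite !size_drop eS.
rewrite -(cat_take_drop k P) -(cat_take_drop k Q) carries_cat // in fPQ.
by apply/carries_cat => //; case: fPQ.
Qed.

Lemma carries_inj f g P Q : code P -> carries f P Q -> carries g P Q -> f = g.
Proof.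
move=> [s ->] [eS fPQ] [_ gPQ]; apply: selfbij_ext => t; apply: val_inj.
have [u uP [y y01 ey]] := cell_cover s (valP t).
have uv : (u, nth [::] Q (index u (leaves s))) \in zip (leaves s) Q.
  rewrite -{1}(nth_index [::] uP) -nth_zip // mem_nth //.
  by rewrite size_zip -eS minnn index_mem.
by rewrite (fPQ _ uv _ _ y01 ey) (gPQ _ uv _ _ y01 ey).
Qed.

Lemma carries_refine f P Q (ts : seq tree) :
  carries f P Q -> carries f (refine (zip P ts)) (refine (zip Q ts)).
Proof.
elim: P Q ts => [|u P IHP] [|v Q] [|s ts] //; try by case.
move=> /carries_consP[fuv fPQ] /=; rewrite !refine_cons.
apply/carries_cat; first by rewrite !size_map.
by split; [apply: carries_map => w _; apply: maps_cat|apply: IHP].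
Qed.

Definition vec_pair (e : bool) f P Q :=
  [/\ rcode P, rcode Q, carries f P Q & map parity Q = map (addb e) (map parity P)].

Definition vec_set : set (selfbij (circle R)) :=
  [set f | exists e P Q, vec_pair e f P Q].

Lemma refine_parity e P Q (ts : seq tree) :
  map parity Q = map (addb e) (map parity P) ->
  map parity (refine (zip Q ts)) =
  map (addb e) (map parity (refine (zip P ts))).
Proof.
elim: P Q ts => [|u P IHP] [|v Q] [|s ts] //= [ev eQ].
rewrite !refine_cons /= !map_cat IHP //; congr (_ ++ _).
by rewrite -!map_comp; apply: eq_map => w /=; rewrite !parity_cat ev addbA.
Qed.

Lemma vec_pair_refine e f P Q (ts : seq tree) :
  vec_pair e f P Q -> size ts = size P ->
  vec_pair e f (refine (zip P ts)) (refine (zip Q ts)).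
Proof.
move=> [rP rQ fPQ ePQ] ets; have eS := fPQ.1.
split; [| |exact: carries_refine|exact: refine_parity];
  by apply: rcode_refine; rewrite unzip1_zip // ets // eS.
Qed.

Lemma vec_pair_rot k e f P Q :
  vec_pair e f P Q -> vec_pair e f (rot k P) (rot k Q).
Proof.
move=> [rP rQ fPQ ePQ]; split; try exact: rcode_rot; first exact: carries_rot.
by rewrite !map_rot ePQ.
Qed.

Lemma vec_set1 : vec_set 1%g.
Proof.
exists false, [:: [::]], [:: [::]]; split=> //; try exact: carries1.
- by apply: code_rcode; exists Leaf.
- by apply: code_rcode; exists Leaf.
Qed.

Lemma vec_setV f : vec_set f -> vec_set f^-1%g.
Proof.
move=> [e [P [Q [rP rQ fPQ ePQ]]]]; exists e, Q, P; split=> //.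
  exact: carriesV.
rewrite ePQ -map_comp -[LHS]map_id; apply: eq_map => b.
by rewrite /= addbA addbb.
Qed.

Lemma vec_setM f g : vec_set f -> vec_set g -> vec_set (f * g)%g.
Proof.
move=> [e [P [Q vf]]] [e' [P' [Q' vg]]].
have [k [s es]] : rcode Q by case: vf.
have {}vf := vec_pair_rot k vf; rewrite {}es in vf.
have [l [t et]] : rcode P' by case: vg.
have {}vg := vec_pair_rot l vg; rewrite {}et in vg.
have eSf : size (leaves s) = size (rot k P) by case: vf => _ _ [].
have {}vf := vec_pair_refine (ts := map (subtree t) (leaves s)) vf.
have {}vg := vec_pair_refine (ts := map (subtree s) (leaves t)) vg.
have zipE a b : zip (leaves a) (map (subtree b) (leaves a)) =
    [seq (u, subtree b u) | u <- leaves a].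
  by elim: (leaves a) => //= u U ->.
rewrite !zipE -!leaves_merge !size_map (merge_treeC t) in vf vg.
have [rP _ fPQ ePQ] := vf eSf; have [_ rQ gPQ gQ] := vg erefl.
do 3![eexists]; split; [exact: rP|exact: rQ|exact: carriesM gPQ|].
rewrite gQ ePQ -map_comp; apply: eq_map => b; exact: addbA.
Qed.

End Maps.

Arguments vec_set R : clear implicits.

(** * Bipartite Thompson graphs and colours of leaves *)

Section ThompsonGraphs.

Lemma nth_rot (T : Type) (x0 : T) k (s : seq T) i :
  k < size s -> i < size s -> nth x0 (rot k s) i = nth x0 s ((i + k) %% size s).
Proof.
move=> ks si; rewrite /rot nth_cat size_drop nth_drop addnC.
case: ltnP => iks; first by rewrite modn_small //; lia.
have ei : i + k = i - (size s - k) + size s by lia.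
by rewrite nth_take; [rewrite ei modnDr modn_small //|]; lia.
Qed.

Lemma rot_modn (T : Type) i k (s : seq T) :
  i < size s -> k < size s -> rot i (rot k s) = rot ((i + k) %% size s) s.
Proof.
move=> si sk; rewrite rot_add_mod ?(ltnW si) ?(ltnW sk) // addnC.
case: (ltngtP (k + i) (size s)) => iks; first by rewrite modn_small.
  have eik : k + i = k + i - size s + size s by lia.
  by rewrite [in RHS]eik modnDr modn_small //; lia.
by rewrite iks modnn rot_size rot0.
Qed.

Lemma rcode_leaves P : rcode P ->
  exists t k, k < nleaves t /\ P = rot k (leaves t).
Proof.
move=> [j [t et]]; exists t.
have : P = rotr j (leaves t) by rewrite -et rotK.
rewrite /rotr size_leaves => ->; have t0 := nleaves_gt0 t.
case: (posnP j) => [->|j0]; last by exists (nleaves t - j); split=> //; lia.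
by exists 0; split=> //; rewrite subn0 -size_leaves rot_size rot0.
Qed.

Lemma tree_edges_bound k t p : p \in tree_edges k t ->
  [/\ k <= p.1 < k + nleaves t & k <= p.2 < k + nleaves t].
Proof.
elim: t k p => //= l IHl r IHr k p; have l0 := nleaves_gt0 l.
have r0 := nleaves_gt0 r; rewrite inE mem_cat.
by case/or3P => [/eqP->|/IHl|/IHr] /=; lia.
Qed.

Lemma tree_edges_colour (c : nat -> bool) k t :
  (forall p, p \in tree_edges k t -> c p.1 != c p.2) <->
  map c (iota k (nleaves t)) = map (addb (c k)) (map parity (leaves t)).
Proof.
elim: t k => [|l IHl r IHr] k; first by split=> //= _; rewrite addbF.
have addC b s : map (addb b) (map (addb true) s) = map (addb (~~ b)) s.
  by rewrite -map_comp; apply: eq_map => a; case: a b => [] [].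
rewrite /= iotaD !map_cat !map_parity_cons addC map_id.
split=> [cE|eE p].
  have ck : c (k + nleaves l) = ~~ c k.
    have /= := cE (k, k + nleaves l); rewrite inE eqxx => /(_ isT).
    by case: (c k) (c (k + _)) => [] [].
  congr (_ ++ _).
    by apply/IHl => p pE; apply: cE; rewrite inE mem_cat pE orbT.
  by rewrite -ck; apply/IHr => p pE; apply: cE; rewrite inE mem_cat pE !orbT.
move/eqP: eE; rewrite eqseq_cat; last by rewrite !size_map size_iota size_leaves.
case/andP=> /eqP el /eqP er.
have ck : c (k + nleaves l) = ~~ c k.
  have := parity_head r; have := nleaves_gt0 r; rewrite -size_leaves.
  move: er; rewrite -(size_leaves r); case: (leaves r) => //= u P [-> _] _ ->.
  by rewrite addbF.
rewrite inE mem_cat; case/or3P=> [/eqP-> /=|pE|pE].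
- by rewrite ck; case: (c k).
- by move/IHl: el; apply.
- by rewrite -ck in er; move/IHr: er; apply.
Qed.

Lemma bipartite_parity (D : triple) :
  bipartite (@thompson_graph D) <->
  exists e, map parity (rot (shift D).-1 (leaves (cod_tree D))) =
            map (addb e) (map parity (leaves (dom_tree D))).
Proof.
case: D => s t k est ks; rewrite /= in est ks *; set D := Triple est ks.
have km : k.-1 < nleaves t by lia.
have t0 := nleaves_gt0 t.
have identE (c : nat -> bool) :
    map (fun i => c (ident D i)) (iota 0 (nleaves s)) =
    rot k.-1 (map c (iota 0 (nleaves t))).
  apply: (@eq_from_nth _ false); first by rewrite size_rot !size_map !size_iota.
  move=> i; rewrite size_map size_iota => si.
  have idt : (i + k.-1) %% nleaves t < nleaves t by rewrite ltn_pmod.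
  rewrite (nth_map 0) ?size_iota // nth_iota // add0n.
  rewrite nth_rot ?size_map ?size_iota //; last by rewrite -est.
  by rewrite (nth_map 0) ?size_iota // nth_iota.
split=> [[c cE]|[e eE]].
  pose c' n := if insub n is Some i then c i else false.
  have c'E (i : 'I_(nleaves t)) : c' i = c i by rewrite /c' valK.
  have id_lt i : ident D i < nleaves t by rewrite /ident ltn_pmod.
  have ct : map c' (iota 0 (nleaves t)) =
      map (addb (c' 0)) (map parity (leaves t)).
    apply/tree_edges_colour => -[i j] ijE.
    have [/= it jt] := tree_edges_bound ijE.
    rewrite -[i]/(val (Ordinal it)) -[j]/(val (Ordinal jt)) !c'E; apply: cE.
    by rewrite /thompson_graph /tree_graph /= ijE.
  have cs : map (fun i => c' (ident D i)) (iota 0 (nleaves s)) =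
      map (addb (c' (ident D 0))) (map parity (leaves s)).
    apply/(tree_edges_colour (fun i => c' (ident D i))) => -[i j] ijE.
    have [/= it jt] := tree_edges_bound ijE.
    rewrite -[ident D i]/(val (Ordinal (id_lt i))).
    rewrite -[ident D j]/(val (Ordinal (id_lt j))) !c'E; apply: cE.
    apply/orP; right; apply/existsP; exists (Ordinal it).
    by apply/existsP; exists (Ordinal jt); rewrite /tree_graph /= ijE !eqxx.
  exists (c' 0 (+) c' (ident D 0)).
  move: cs; rewrite identE ct -!map_rot => /(congr1 (map (addb (c' 0)))).
  rewrite -!map_comp => eP; transitivity
    [seq (addb (c' 0) \o (addb (c' 0) \o parity)) i | i <- rot k.-1 (leaves t)].
    by apply: eq_map => u /=; rewrite addbA addbb.
  by rewrite eP; apply: eq_map => u /=; rewrite addbA.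
pose c n := parity (nth [::] (leaves t) n).
have cE : map c (iota 0 (nleaves t)) = map parity (leaves t).
  by rewrite -size_leaves (map_comp parity) map_nth_iota0 ?take_size.
have ct : map c (iota 0 (nleaves t)) = map (addb (c 0)) (map parity (leaves t)).
  have -> : c 0 = false.
    by have := parity_head t; rewrite /c; case: (leaves t).
  by rewrite cE [RHS]map_id.
have cs : map (fun i => c (ident D i)) (iota 0 (nleaves s)) =
    map (addb (c (ident D 0))) (map parity (leaves s)).
  move: (identE c); rewrite cE -map_rot eE => eI; rewrite eI.
  congr (map (addb _) _).
  move: eI; have := parity_head s; rewrite -size_leaves.
  by case: (leaves s) => //= u P -> [-> _]; rewrite addbF.
exists (fun i : 'I_(nleaves t) => c i) => u v.
case/orP=> [uv|/existsP[x /existsP[y /and3P[/eqP<- /eqP<- xy]]]].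
  by case/orP: uv => /(proj2 (tree_edges_colour _ _ _) ct); rewrite // eq_sym.
by case/orP: xy => /(proj2 (tree_edges_colour _ _ _) cs); rewrite // eq_sym.
Qed.

Lemma leaf_caretsP k t i : i \in leaf_carets k t ->
  exists X u Y, [/\ leaves t = X ++ rcons u false :: rcons u true :: Y,
                    i = k + size X & code (X ++ u :: Y)].
Proof.
elim: t k => // l IHl r IHr k.
have [[-> ->]|->] : (l = Leaf /\ r = Leaf) \/ leaf_carets k (Node l r) =
    leaf_carets k l ++ leaf_carets (k + nleaves l) r.
  by case: (l) => [|? ?]; case: (r) => [|? ?]; [left|right..].
  rewrite inE => /eqP ->; exists [::], [::], [::]; split=> //.
    by rewrite addn0.
  exact: (code_leaves Leaf).
rewrite mem_cat => /orP[/IHl|/IHr] [X [u [Y [eX -> cX]]]].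
  exists (map (cons false) X), (false :: u).
  exists (map (cons false) Y ++ map (cons true) (leaves r)); split.
  - by rewrite /= eX map_cat -catA.
  - by rewrite size_map.
  - by have := code_node cX (code_leaves r); rewrite map_cat -catA.
exists (map (cons false) (leaves l) ++ map (cons true) X), (true :: u).
exists (map (cons true) Y); split.
- by rewrite /= eX map_cat -catA.
- by rewrite size_cat !size_map size_leaves addnA.
- by have := code_node (code_leaves l) cX; rewrite map_cat catA.
Qed.

Lemma rot_leaf_carets t i : i \in leaf_carets 0 t ->
  i < nleaves t /\ exists u Z,
    rot i (leaves t) = rcons u false :: rcons u true :: Z /\ rcode (u :: Z).
Proof.
move=> /leaf_caretsP[X [u [Y [eX -> cX]]]]; rewrite add0n; split.
  by rewrite -size_leaves eX size_cat /=; lia.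
exists u, (Y ++ X); split; first by rewrite eX rot_size_cat.
have := rcode_rot (size X) (code_rcode cX).
by rewrite rot_size_cat.
Qed.

Variable R : realType.

Local Open Scope ring_scope.

Lemma leaf_intervalsE t (a b : R) : leaf_intervals t a b =
  [seq (a + (b - a) * cell u 0, a + (b - a) * cell u 1) | u <- leaves t].
Proof.
elim: t a b => [|l IHl r IHr] a b /=; first by congr [:: (_, _)]; rewrite /=; ring.
rewrite IHl IHr map_cat -!map_comp.
by congr (_ ++ _); apply: eq_map => u /=; congr (_, _); field.
Qed.

Lemma mapsE (f : selfbij (circle R)) u v : maps f u v <->
  forall t : circle R, cell u 0 <= val t < cell u 1 -> val (f t) =
    cell v 0 + (cell v 1 - cell v 0) / (cell u 1 - cell u 0) *
      (val t - cell u 0).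
Proof.
have d0 : 0 < cell u 1 - cell u (0 : R) by rewrite subr_gt0 cell_lt.
split=> fuv.
  move=> t tu; pose x := (val t - cell u 0) / (cell u 1 - cell u 0).
  have x01 : 0 <= x < 1.
    case/andP: tu => tu0 tu1; apply/andP; split.
      by rewrite divr_ge0 ?subr_ge0 // ltW // -subr_gt0.
    by rewrite ltr_pdivrMr // mul1r ltrD2r.
  rewrite (fuv x) //.
    by rewrite cell_affine /x -mulrA [_^-1 * _]mulrC.
  by rewrite cell_affine /x mulrC divfK ?gt_eqF // addrC subrK.
move=> x t x01 et; rewrite fuv et.
  rewrite (cell_affine u x) (cell_affine v x) [cell u 0 + _]addrC addrK.
  by rewrite mulrA divfK ?gt_eqF.
rewrite (cell_affine u x); case/andP: x01 => x0 x1; apply/andP; split.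
  by rewrite lerDl mulr_ge0 // ltW.
by rewrite -ltrBrDl gtr_pMr.
Qed.

Lemma carries_nth (f : selfbij (circle R)) P Q : carries f P Q <->
  size P = size Q /\
  forall i, (i < size P)%N -> maps f (nth [::] P i) (nth [::] Q i).
Proof.
split=> -[eS fPQ]; split=> //.
  move=> i iP; apply: (fPQ (nth [::] P i, nth [::] Q i)).
  by rewrite -nth_zip // mem_nth // size_zip -eS minnn.
move=> p /(nthP ([::], [::]))[i]; rewrite size_zip -eS minnn => iP <-.
by rewrite nth_zip //; apply: fPQ.
Qed.

Lemma represents_carries D (f : selfbij (circle R)) :
  represents D f <->
  carries f (leaves (dom_tree D)) (rot (shift D).-1 (leaves (cod_tree D))).
Proof.
case: D => s t k est ks; rewrite /= in est ks *; set D := Triple est ks.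
have eS : size (leaves s) = size (leaves t) by rewrite !size_leaves.
have id_lt i : (ident D i < size (leaves t))%N.
  by rewrite /ident size_leaves ltn_pmod ?nleaves_gt0.
rewrite carries_nth size_rot; split=> [rf|[_ fC]].
  split=> // i; rewrite size_leaves => si; apply/mapsE => x.
  have := rf i si x; rewrite !leaf_intervalsE.
  rewrite !(nth_map [::]) ?size_leaves //= -?size_leaves //.
  rewrite nth_rot -?eS ?size_leaves //; last by lia.
  by rewrite est !subr0 !mul1r !add0r.
move=> i si I J x; rewrite /I /J !leaf_intervalsE.
rewrite !(nth_map [::]) ?size_leaves //= -?size_leaves //.
have := fC i; rewrite size_leaves => /(_ si)/mapsE/(_ x).
rewrite nth_rot -?eS ?size_leaves //; last by lia.
by rewrite est !subr0 !mul1r !add0r.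
Qed.

Lemma vec_T_sub : (vec_T R `<=` vec_set R)%classic.
Proof.
move=> f [_ [D [_ /represents_carries fD /bipartite_parity[e eD]]]].
exists e, (leaves (dom_tree D)), (rot (shift D).-1 (leaves (cod_tree D))).
by split=> //; [|apply: rcode_rot]; apply/code_rcode/code_leaves.
Qed.

Lemma vec_set_sub : (vec_set R `<=` vec_T R)%classic.
Proof.
move=> f [e [P [Q]]]; have [n] := ubnP (size P).
elim: n P Q => // n IHn P Q; rewrite ltnS => Pn fPQ.
have [j [s es]] : rcode P by case: fPQ.
have {}fPQ := vec_pair_rot j fPQ.
have {}Pn : (size (rot j P) <= n)%N by rewrite size_rot.
move: {P} (rot j P) es Pn (rot j Q) fPQ => {Q} P -> Pn Q fPQ.
have [t [k [kt eQ]]] : exists t k, (k < nleaves t)%N /\ Q = rot k (leaves t).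
  by case: fPQ => _ /rcode_leaves.
have est : nleaves s = nleaves t.
  by case: fPQ => _ _ [eS _] _; rewrite -!size_leaves eS eQ size_rot.
have ks : (1 <= k.+1 <= nleaves s)%N by rewrite est.
pose D := Triple est ks.
have fD : represents D f by apply/represents_carries; rewrite /= -eQ; case: fPQ.
have bD : bipartite (@thompson_graph D).
  by apply/bipartite_parity; exists e; rewrite /= -eQ; case: fPQ.
have [rD|] := pselect (reduced D); first by split; exists D.
move=> /contrapT[i [j0 [/= si sj ej _]]]; rewrite -ej in sj.
have [lt_i [u [Z [eZ rZ]]]] := rot_leaf_carets si.
have [_ [v [Z' [eZ' rZ']]]] := rot_leaf_carets sj.
have eQi : rot i Q = rot (ident D i) (leaves t).
  by rewrite eQ rot_modn ?size_leaves -?est // /ident /= est.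
have := vec_pair_rot i fPQ; rewrite eQi eZ eZ' => -[_ _ + /= [_ ev eZp]].
move=> /carries_consP[fu0 /carries_consP[fu1 fZ]].
apply: (IHn (u :: Z) (v :: Z')).
  have := congr1 size eZ; rewrite size_rot /= => eS.
  by rewrite /=; lia.
split=> //; first by apply: carries_cons => //; apply: maps_join.
rewrite /= eZp; congr (_ :: _); move: ev.
by rewrite -!cats1 !parity_cat /= !addbT addbN => /negb_inj.
Qed.

End ThompsonGraphs.

(** * Generation *)

Section Generators.
Variable R : realType.
Local Notation word := (seq bool).
Local Notation ones n := (nseq n true).

Section XFun.
Local Open Scope ring_scope.

Lemma x_fun0 n : x_fun n (0 : R) = 0.
Proof. by case: n => [|n] /=; rewrite ifT //; lra. Qed.

Definition fmaps (h : R -> R) (u v : word) :=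
  forall x, 0 <= x < 1 -> h (cell u x) = cell v x.

Lemma fmaps_maps n u v : fmaps (x_fun n) u v -> maps (x_ R n) u v.
Proof. by move=> huv x t x01 /= ->; apply: huv. Qed.

Lemma fmaps_true n u v :
  fmaps (x_fun n) u v -> fmaps (x_fun n.+1) (true :: u) (true :: v).
Proof.
move=> huv x x01 /=; have := huv x x01.
have := cell01 u x01; have := cell01 v x01.
set a := cell u x; set b := cell v x => b01 a01 hab.
have ea : 2 * ((1 + a) / 2) - 1 = a by lra.
case: leP => a2; last by rewrite ea hab addrC.
have a0 : a = 0 by lra.
by move: hab; rewrite a0 x_fun0 => <-.
Qed.

Lemma fmaps_false n u : fmaps (x_fun n.+1) (false :: u) (false :: u).
Proof. by move=> x /(cell01 u) x01 /=; rewrite ifT //; lra. Qed.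

Lemma fmaps_ones n u v :
  fmaps (x_fun 0) u v -> fmaps (x_fun n) (ones n ++ u) (ones n ++ v).
Proof. by move=> huv; elim: n => //= n IHn; apply: fmaps_true. Qed.

Lemma x_tooth n j : (j < n)%N -> maps (x_ R n) (tooth j) (tooth j).
Proof.
move=> jn; apply: fmaps_maps; elim: n j jn => // n IHn [|j] jn.
  exact: fmaps_false.
exact/fmaps_true/IHn.
Qed.

Lemma x_00 n : maps (x_ R n) (ones n ++ [:: false; false]) (ones n ++ [:: false]).
Proof.
by apply/fmaps_maps/fmaps_ones => x x01 /=; rewrite ifT; lra.
Qed.

Lemma x_01 n :
  maps (x_ R n) (ones n ++ [:: false; true]) (ones n ++ [:: true; false]).
Proof.
by apply/fmaps_maps/fmaps_ones => x x01 /=; rewrite ifF ?ifT; lra.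
Qed.

Lemma x_1 n : maps (x_ R n) (ones n ++ [:: true]) (ones n ++ [:: true; true]).
Proof.
by apply/fmaps_maps/fmaps_ones => x x01 /=; rewrite !ifF; lra.
Qed.

Lemma x_funS n (t : R) : x_fun n.+1 t =
  if t <= 1 / 2 then t else (x_fun n (2 * t - 1) + 1) / 2.
Proof. by []. Qed.

Lemma x_fun_gt_half n (t : R) : 1 / 2 < t -> 1 / 2 < x_fun n.+1 t.
Proof.
move=> t2 /=; rewrite ifF; last by lra.
by have := @x_fun_gt0 R n (2 * t - 1); lra.
Qed.

Lemma x_fun_comm k n (t : R) : (k < n)%N ->
  x_fun k (x_fun n t) = x_fun n.+1 (x_fun k t).
Proof.
elim: k n t => [|k IHk] [|n] // t kn; case: (leP t (1 / 2)) => t2.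
- have -> : x_fun n.+1 t = t by rewrite x_funS t2.
  rewrite x_funS; case: ifP => //.
  by rewrite /=; case: (ltP t (1 / 4)) => ?; [|case: (ltP t (1 / 2)) => ?];
    try lra; case: ifP; lra.
- have := x_fun_gt_half n t2; have -> : x_fun 0 t = (t + 1) / 2.
    by rewrite /= !ifF; lra.
  move=> n2; rewrite (x_funS n.+1) ifF; last by lra.
  have -> : 2 * ((t + 1) / 2) - 1 = t by lra.
  by move: (x_fun n.+1 t) n2 => s s2; rewrite /= !ifF; lra.
- by rewrite (x_funS n t) (x_funS k t) t2 !x_funS t2.
- have xt m : x_fun m.+1 t = (x_fun m (2 * t - 1) + 1) / 2.
    by rewrite x_funS ifF //; lra.
  have xx p m : x_fun p.+1 ((x_fun m (2 * t - 1) + 1) / 2) =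
      (x_fun p (x_fun m (2 * t - 1)) + 1) / 2.
    have := @x_fun_gt0 R m (2 * t - 1); move: (x_fun m _) => s s0.
    rewrite x_funS ifF; last by lra.
    by have -> : 2 * ((s + 1) / 2) - 1 = s by lra.
  by rewrite !xt !xx IHk.
Qed.

End XFun.

Local Open Scope group_scope.

Lemma ones_true n s : ones n ++ true :: s = ones n.+1 ++ s.
Proof. by elim: n => //= n ->. Qed.

Lemma toothE n : tooth n = ones n ++ [:: false].
Proof. by rewrite cats1. Qed.

Lemma combS n : comb n.+1 = mkseq tooth n ++ [:: tooth n; ones n.+1].
Proof. by rewrite -addn1 comb_add /= ones_true cats0 -toothE addn1. Qed.

Definition y_ (i : nat) : selfbij (circle R) := x_ R i * x_ R i.+1.

Lemma x_comm k n : k < n -> x_ R n * x_ R k = x_ R k * x_ R n.+1.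
Proof.
by move=> kn; apply: selfbij_ext => t; apply: val_inj; exact: x_fun_comm.
Qed.

Lemma y_conj n : y_ n.+3 = (y_ 0)^-1 * (y_ n.+1 * y_ 0).
Proof.
apply: (canRL (mulKg _)); rewrite /y_ !mulgA.
rewrite -(mulgA _ (x_ R n.+2) (x_ R 0)) (@x_comm 0 n.+2) // !mulgA.
rewrite (@x_comm 0 n.+1) // -(mulgA _ (x_ R n.+3) (x_ R 1)).
rewrite (@x_comm 1 n.+3) // !mulgA.
by rewrite -(mulgA _ (x_ R n.+2) (x_ R 1)) (@x_comm 1 n.+2) // !mulgA.
Qed.

Lemma y_tooth i j : j < i -> maps (y_ i) (tooth j) (tooth j).
Proof. by move=> ji; apply: mapsM; apply: x_tooth; rewrite // ltnW. Qed.

Lemma y_0 i : maps (y_ i) (tooth i ++ [:: false]) (tooth i).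
Proof.
apply: (mapsM (v := tooth i)); last exact: x_tooth.
by rewrite toothE -catA; apply: x_00.
Qed.

Lemma y_10 i : maps (y_ i) (tooth i ++ [:: true; false]) (tooth i.+1).
Proof.
rewrite !toothE -catA; apply: (mapsM (v := ones i.+1 ++ [:: false; false])).
  rewrite -ones_true; have := maps_cat (w := [:: false]) (@x_01 i).
  by rewrite -!catA.
exact: x_00.
Qed.

Lemma y_11 i : maps (y_ i) (tooth i ++ [:: true; true]) (tooth i.+2).
Proof.
rewrite !toothE -catA; apply: (mapsM (v := ones i.+1 ++ [:: false; true])).
  rewrite -ones_true; have := maps_cat (w := [:: true]) (@x_01 i).
  by rewrite -!catA.
by have := @x_01 i.+1; rewrite ones_true.
Qed.

Lemma y_ones i : maps (y_ i) (ones i.+1) (ones i.+3).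
Proof.
have e n : ones n.+1 = ones n ++ [:: true] by rewrite ones_true cats0.
apply: (mapsM (v := ones i.+2)).
  by rewrite !e -catA; apply: x_1.
by have := @x_1 i.+1; rewrite !ones_true !cats0.
Qed.

Definition fork (u : word) : seq word :=
  [:: u ++ [:: false]; u ++ [:: true; false]; u ++ [:: true; true]].

Lemma y_carries i r :
  carries (y_ i)
    (mkseq tooth i ++ fork (tooth i) ++ map (cat (ones i.+1)) (comb r))
    (comb (i + r.+3)).
Proof.
rewrite comb_add; apply/carries_cat; rewrite ?size_mkseq //; split.
  by apply: carries_map => j; rewrite mem_iota => /y_tooth.
rewrite /= -!map_comp !ones_true -!toothE.
apply: carries_cons; first exact: y_0.
apply: carries_cons; first exact: y_10.
apply: carries_cons; first exact: y_11.
apply: carries_map => u _ /=; rewrite !ones_true.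
by have := maps_cat (w := u) (@y_ones i).
Qed.

Lemma half_turn_false : maps (half_turn R) [:: false] [:: true].
Proof.
by move=> x t x01 /= et; rewrite /half_turn_fun et ifT; lra.
Qed.

Lemma half_turn_true : maps (half_turn R) [:: true] [:: false].
Proof.
by move=> x t x01 /= et; rewrite /half_turn_fun et ifF; lra.
Qed.

Lemma half_turn_vec : vec_set R (half_turn R).
Proof.
exists true, [:: [:: false]; [:: true]], [:: [:: true]; [:: false]]; split=> //.
- by apply: code_rcode; exists caret.
- by exists 1%N, caret.
- apply: carries_cons; first exact: half_turn_false.
  apply: carries_cons; first exact: half_turn_true.
  exact: carries_nil.
Qed.

Lemma y_vec i : vec_set R (y_ i).
Proof.
exists false, (mkseq tooth i ++ fork (tooth i) ++ [:: ones i.+1]), (comb (i + 3)).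
split.
- have := code_rcode (code_comb i.+1); rewrite combS => /rcode_split; rewrite -cat_rcons => /rcode_split.
  by rewrite cat_rcons -!cats1 -!catA.
- exact/code_rcode/code_comb.
- by have := y_carries i 0; rewrite /= cats0.
- rewrite [RHS]map_id comb_add !map_cat; congr (_ ++ _).
  rewrite toothE /=; rewrite !parity_cat /=.
  have -> : true :: ones i = ones i ++ [:: true] by rewrite ones_true cats0.
  by rewrite !parity_cat; case: (parity _).
Qed.

Section Generation.
Variable H : set (selfbij (circle R)).
Hypothesis H1 : H 1.
Hypothesis HM : forall f g, H f -> H g -> H (f * g).
Hypothesis HV : forall f, H f -> H f^-1.
Hypothesis Hturn : H (half_turn R).
Hypothesis Hy0 : H (y_ 0).
Hypothesis Hy1 : H (y_ 1).
Hypothesis Hy2 : H (y_ 2).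

Lemma mem_y i : H (y_ i).
Proof.
case: i => // i; suff [] : H (y_ i.+1) /\ H (y_ i.+2) by [].
elim: i => // i [Hi Hi1]; split=> //; rewrite y_conj.
by apply: HM; [apply: HV|apply: HM].
Qed.

(* Grafting a fork on leaf [n] of the comb with [n.+2] leaves and on its image
   under the rotation, the last leaf, gives, up to [y_ n] in the domain, the
   rotation of the comb with [n.+4] leaves. *)
Lemma comb_rotation j : exists2 f, H f &
  carries f (comb j.*2.+1) (rot 1 (comb j.*2.+1)).
Proof.
suff [f Hf [f1 f2 f3]] : exists2 f, H f & [/\
    forall i, i < j.*2 -> maps f (tooth i) (tooth i.+1),
    maps f (tooth j.*2) (ones j.*2.+1) & maps f (ones j.*2.+1) [:: false]].
  exists f => //; rewrite rot_comb combS; apply/carries_cat.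
    by rewrite size_map !size_mkseq.
  split.
    rewrite /mkseq -map_comp; apply: carries_map => i.
    by rewrite mem_iota => /f1.
  apply: carries_cons => //.
  by apply: carries_cons => //; apply: carries_nil.
elim: j => [|j [f Hf [f1 f2 f3]]].
  exists (half_turn R) => //; split=> //.
    exact: half_turn_false.
  exact: half_turn_true.
rewrite doubleS; set n := j.*2 in f1 f2 f3 *.
exists ((y_ n)^-1 * f); first by apply: HM => //; apply: HV; apply: mem_y.
split.
- move=> i; rewrite ltnS leq_eqVlt => /orP[/eqP->|].
    apply: mapsM (mapsV (@y_10 n)) _; have := maps_cat (w := [:: true; false]) f2.
    by rewrite (toothE n.+2) ones_true.
  rewrite ltnS leq_eqVlt => /orP[/eqP->|lt_in].
    apply: mapsM (mapsV (@y_0 n)) _; have := maps_cat (w := [:: false]) f2.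
    by rewrite -toothE.
  by apply: mapsM (mapsV (y_tooth lt_in)) _; apply: f1.
- apply: mapsM (mapsV (@y_11 n)) _; have := maps_cat (w := [:: true; true]) f2.
  by rewrite !ones_true cats0.
- exact: mapsM (mapsV (@y_ones n)) f3.
Qed.

Lemma comb_rotations j k : exists2 f, H f &
  carries f (comb j.*2.+1) (rot k (comb j.*2.+1)).
Proof.
have [f Hf f1] := comb_rotation j; elim: k => [|k [g Hg gk]].
  by exists 1 => //; rewrite rot0; apply: carries1.
have [lt_k|le_k] := ltnP k (size (comb j.*2.+1)); last first.
  exists g => //; rewrite rot_oversize ?(leqW le_k) //.
  by rewrite rot_oversize in gk.
exists (g * f); first exact: HM.
rewrite rotS // rot_rot; apply: carriesM gk _.
exact: carries_rot.
Qed.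

Lemma carries_comb P : code P -> alternating (map parity P) ->
  exists2 g, H g & exists k, carries g P (comb k).
Proof.
have [n] := ubnP (size P); elim: n P => // n IHn P + [t eP].
rewrite {}eP ltnS => Pn alt.
have srt : sorted (fun a b => a != b) (map parity (leaves t)).
  move: alt; rewrite /alternating; case: (map _ _) => //= a s.
  by rewrite rcons_path => /andP[].
case: (alternating_leaves srt) => [et|->|[X [u [Y [eX cX]]]]].
- by rewrite et in alt.
- by exists 1 => //; exists 1%N; apply: carries1.
have [|||g Hg [k gk]] := IHn (X ++ u :: Y) => //.
- apply: leq_trans Pn; rewrite eX !size_cat /=; lia.
- move: alt; rewrite eX !map_cat /= => /alternating_remove.
  by rewrite parity_cat addbF.
rewrite eX; set i := size X; have [r ek] : exists r, k = i + r.
  exists (k - i); have := gk.1; rewrite size_cat size_comb /= -/i; lia.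
rewrite {}ek comb_add in gk; move: gk.
rewrite (carries_cat _ _ _ (esym (size_mkseq _ _))) => -[gX].
case: r => [|r] /= /carries_consP[gu gY].
  exists g => //; exists (i + 2)%N; rewrite comb_add.
  apply/carries_cat; rewrite ?size_mkseq //; split=> //=.
  have {gY} -> : Y = [::] by case: (Y) gY => // ? ? [].
  by do 3![apply: carries_cons;
    first by have := maps_cat (w := _) gu; rewrite cats0; apply];
    apply: carries_nil.
exists (g * y_ i); first by apply: HM => //; apply: mem_y.
exists (i + r.+3)%N; apply: carriesM _ (y_carries i r).
apply/carries_cat; rewrite ?size_mkseq //; split=> //.
rewrite -toothE in gu; rewrite -map_comp in gY.
do 3![apply: carries_cons; first exact: maps_cat].
rewrite (eq_map (g := cat (ones i.+1))) // in gY.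
by move=> w; rewrite /= ones_true.
Qed.

Lemma vec_set_generated : (vec_set R `<=` H)%classic.
Proof.
move=> f [e [P [Q fPQ]]].
have P0 : P != [::].
  have [j [s es]] : rcode P by case: fPQ.
  apply/eqP => eP; have := nleaves_gt0 s.
  by rewrite -size_leaves -es eP.
have alt := alternating_separators P0.
have := vec_pair_refine fPQ (etrans (size_separators _ _) (size_map parity P)).
move=> {P0 fPQ} /(_ (head true (map parity P))) fPQ.
move: (refine _) (refine _) fPQ alt => {}Q {}P fPQ alt.
have [j [s es]] : rcode P by case: fPQ.
have {}fPQ := vec_pair_rot j fPQ.
have {}alt : alternating (map parity (rot j P)).
  by rewrite /alternating map_rot rot_cycle.
move: (rot j P) (rot j Q) (ex_intro (fun t => _ = leaves t) s es) fPQ alt.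
move=> {j s es} {}P {}Q cP [_ rQ fPQ ePQ] altP.
have [t [l [lt eQ]]] := rcode_leaves rQ.
have altt : alternating (map parity (leaves t)).
  move: altP; rewrite /alternating.
  rewrite -[in X in _ -> X](rot_cycle l) -map_rot -eQ ePQ.
  by rewrite -[cycle _ (map (addb e) _)]/(alternating _) alternating_addb.
have [g Hg [k gP]] := carries_comb cP altP.
have [h Hh [k' hQ]] := carries_comb (code_leaves t) altt.
have ek : k' = k.
  have := fPQ.1; rewrite eQ size_rot hQ.1 gP.1 !size_comb; lia.
rewrite {}ek in hQ.
have [j ej] : exists j, k = j.*2.+1.
  exists k./2; have := alternating_even altP.
  rewrite size_map gP.1 size_comb /= negbK => ok.
  by rewrite -add1n -{1}(odd_double_half k) ok.
rewrite {}ej in gP hQ; have [r Hr rC] := comb_rotations j l.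
have -> : f = g * r * h^-1.
  apply: (canRL (mulgK _)); apply: (carries_inj cP).
    by apply: carriesM fPQ _; rewrite eQ; apply: carries_rot hQ.
  exact: carriesM gP rC.
by apply: HM; [exact: HM|exact: HV].
Qed.

End Generation.

End Generators.

Lemma group_closedP (G : groupType) (H : set G) : group_closed (mem H) <->
  [/\ H 1%g, forall f g, H f -> H g -> H (f * g)%g & forall f, H f -> H f^-1%g].
Proof.
split=> [cH|[H1 HM HV]].
  split=> [|f g Hf Hg|f Hf].
  - by have := cH.1; rewrite inE.
  - by have := group_closedM cH (mem_set Hf) (mem_set Hg); rewrite inE.
  - by have := group_closedV cH (mem_set Hf); rewrite inE.
split; first exact: mem_set.
by move=> f g /set_mem Hf /set_mem Hg; apply/mem_set/HM => //; apply: HV.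
Qed.

Local Open Scope group_scope.
Local Open Scope classical_set_scope.

Theorem theorem1 (R : realType) :
  vec_T R = generated (vec_F R `|` [set half_turn R]) /\
  generated (vec_F R `|` [set half_turn R]) =
    generated [set x_ R 0 * x_ R 1; x_ R 1 * x_ R 2; x_ R 2 * x_ R 3; half_turn R].
Proof.
set A := _ `|` _; set B := [set _; _; _; _].
have eT : vec_T R = vec_set R.
  by apply/seteqP; split; [exact: vec_T_sub|exact: vec_set_sub].
have yF i : vec_F R (y_ R i).
  have yT : vec_T R (y_ R i) by rewrite eT; apply: y_vec.
  split=> //; split; first by case: yT.
  move=> t t0; change (x_fun i.+1 (x_fun i (val t)) = 0%R).
  by rewrite t0 !x_fun0.
have BA : B `<=` A.
  by move=> f [[[->|->]|->]|->]; [left; exact: yF..|right].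
have AT : generated A `<=` vec_T R.
  apply: smallest_sub; last first.
    by move=> f [[]//|->]; rewrite eT; apply: half_turn_vec.
  rewrite eT; apply/group_closedP.
  by split; [exact: vec_set1|exact: vec_setM|exact: vec_setV].
have TB : vec_T R `<=` generated B.
  rewrite eT => f vf H [/group_closedP[H1 HM HV] BH].
  by apply: (vec_set_generated H1 HM HV) vf; apply: BH; rewrite /B /=; tauto.
have BAg : generated B `<=` generated A.
  by move=> f fB H [cH AH]; apply: fB; split=> //; apply: subset_trans AH.
split; apply/seteqP; split=> //.
- exact: subset_trans BAg.
- exact: subset_trans TB.
Qed.
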